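(* Let $X$ be a Banach space, let $T:X\rightrightarrows X^*$ be a regular maximal monotone multifunction and let $S:X\rightrightarrows X^*$ be a bounded maximal monotone multifunction. Then $T+S$ is maximal monotone.
   Context: $X$ is a (real) Banach space with topological dual $X^*$ and $\langle x^*,x\rangle=\langle x,x^*\rangle$ denotes the evaluation pairing. For a multifunction $T:X\rightrightarrows X^*$, its graph is $G(T)=\{(x,x^* )\in X\times X^*: x^*\in T(x)\}$ and its domain is $D_T=\{x\in X: T(x)\neq\emptyset\}$. $T$ is monotone if $\langle x^*-y^*,x-y\rangle\ge 0$ for all $(x,x^* ),(y,y^* )\in G(T)$; it is maximal monotone if it is monotone and there is no monotone multifunction $S:X\rightrightarrows X^*$ whose graph strictly contains $G(T)$. The sum is defined by $(T+S)(x)=T(x)+S(x)=\{x^*+u^*: x^*\in T(x),\ u^*\in S(x)\}$. $S$ is bounded if there is $M\ge 0$ with $\|u^*\|\le M$ for all $(y,u^* )\in G(S)$. For $(x,x^* )\in X\times X^*$ put $$L(x,x^*,T)=\max\left\{0,\ \sup\left\{\frac{\langle x^*-y^*,y-x\rangle}{\|x-y\|}: (y,y^* )\in G(T),\ y\neq x\right\}\right\}\in[0,\infty],$$ and $d(x^*,T(x))=\inf\{\|y^*-x^*\|: y^*\in T(x)\}$, with $d(x^*,\emptyset)=\infty$. A maximal monotone multifunction $T$ is called regular if $L(x,x^*,T)=d(x^*,T(x))$ for every $(x,x^* )\in X\times X^*$. *)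

(* Defs.v *)
From HB Require Import structures.
From mathcomp Require Import all_boot all_order all_algebra.
From mathcomp Require Import all_classical all_reals all_analysis.

Set Implicit Arguments.
Unset Strict Implicit.
Unset Printing Implicit Defensive.

Import Order.TTheory GRing.Theory Num.Theory.
Import numFieldNormedType.Exports.

Local Open Scope classical_set_scope.
Local Open Scope ring_scope.

Definition dual_pred (R : realType) (X : normedModType R) : {pred X -> R^o} :=
  fun f => `[< linear f /\ continuous f >].

(* The topological dual: a subtype of the plain functions, so that functionals
   are equal iff they agree pointwise and the operations are pointwise. *)
Record dual (R : realType) (X : normedModType R) := Dual {
  dual_fun :> X -> R^o ;
  dual_funP : dual_fun \in @dual_pred R X }.

Section dual_lmodule.
Context (R : realType) (X : normedModType R).

HB.instance Definition _ := [isSub for @dual_fun R X].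
HB.instance Definition _ := [Choice of dual X by <:].

Lemma dual_submod_closed : submod_closed (@dual_pred R X).
Proof.
split=> [|a f g]; rewrite !inE.
  by split=> [a x y|x]; [rewrite /= scaler0 addr0 | exact: cvg_cst].
move=> [lf cf] [lg cg]; split=> [b x y|x].
  by rewrite !fctE lf lg !scalerDr !scalerA (mulrC a b) addrACA.
apply: cvgD; last exact: cg.
by apply: cvgZr; exact: cf.
Qed.

HB.instance Definition _ :=
  GRing.isSubmodClosed.Build _ _ (@dual_pred R X) dual_submod_closed.
HB.instance Definition _ := [SubChoice_isSubLmodule of dual X by <:].

End dual_lmodule.

Section dual_norm.
Context (R : realType) (X : normedModType R).
Implicit Types f g : dual X.

Lemma dual_linear f : linear f.
Proof. by have /[!inE] -[] := dual_funP f. Qed.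

Lemma dual_continuous f : continuous f.
Proof. by have /[!inE] -[] := dual_funP f. Qed.

HB.instance Definition _ f :=
  GRing.isLinear.Build R X R^o *:%R (dual_fun f) (dual_linear f).

Lemma dualP f g : f =1 g -> f = g.
Proof. by move=> fg; apply/val_inj/funext. Qed.

(* A real supremum: it is a genuine one by [dual_has_sup]. *)
Definition dual_norm f : R := sup [set `|f x| | x in [set x : X | `|x| <= 1]].

Lemma dual_has_sup f : has_sup [set `|f x| | x in [set x : X | `|x| <= 1]].
Proof.
split; first by exists `|f 0|, 0; rewrite //= normr0.
have /linear_bounded_continuous/linear_boundedP := @dual_continuous f.
move=> /pinfty_ex_gt0 [M M0 fM]; exists M => _ [x /= x1 <-].
by rewrite (le_trans (fM x))// ler_piMr// ltW.
Qed.

Lemma dual_normP f x : `|f x| <= dual_norm f * `|x|.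
Proof.
have [->|x0] := eqVneq x 0; first by rewrite linear0 !normr0 mulr0.
rewrite -ler_pdivrMr ?normr_gt0//.
apply: sup_upper_bound; first exact: dual_has_sup.
exists (`|x|^-1 *: x) => /=.
  by rewrite normrZ normfV normr_id mulVf ?normr_eq0.
by rewrite linearZ/= normrZ normfV normr_id mulrC.
Qed.

Lemma dual_norm_le f (M : R) : 0 <= M ->
  (forall x, `|f x| <= M * `|x|) -> dual_norm f <= M.
Proof.
move=> M0 fM; apply: ge_sup; first by have [] := dual_has_sup f.
by move=> _ [x /= x1 <-]; rewrite (le_trans (fM x))// ler_piMr.
Qed.

Lemma dual_norm_ge0 f : 0 <= dual_norm f.
Proof.
apply: sup_upper_bound; first exact: dual_has_sup.
by exists 0; rewrite /= ?linear0 normr0.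
Qed.

Lemma ler_dual_normD f g : dual_norm (f + g) <= dual_norm f + dual_norm g.
Proof.
apply: dual_norm_le => [|x]; first by rewrite addr_ge0// dual_norm_ge0.
by rewrite mulrDl (le_trans (ler_normD _ _))// lerD// dual_normP.
Qed.

Lemma dual_normZ (a : R) f : dual_norm (a *: f) = `|a| * dual_norm f.
Proof.
have leZ b g : dual_norm (b *: g) <= `|b| * dual_norm g.
  apply: dual_norm_le => [|x]; first by rewrite mulr_ge0// dual_norm_ge0.
  by rewrite [leLHS]normrZ -mulrA ler_wpM2l// dual_normP.
apply/eqP; rewrite eq_le leZ/=; have [->|a0] := eqVneq a 0.
  by rewrite normr0 mul0r dual_norm_ge0.
rewrite -ler_pdivlMl ?normr_gt0// -normfV.
by rewrite (le_trans _ (leZ _ _))// scalerA mulVf// scale1r.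
Qed.

Lemma dual_norm0_eq0 f : dual_norm f = 0 -> f = 0.
Proof.
move=> f0; apply: dualP => x; apply/eqP.
by rewrite -normr_le0 (le_trans (dual_normP f x))// f0 mul0r.
Qed.

HB.instance Definition _ := Lmodule_isNormed.Build R (dual X)
  ler_dual_normD dual_normZ dual_norm0_eq0.

Lemma dual_normE f : `|f| = dual_norm f.
Proof. by []. Qed.

End dual_norm.

Section multifunctions.
Context (R : realType) (X : normedModType R).
Implicit Types (T S : X -> set (dual X)) (x : X) (xs : dual X).

Definition multifun_graph T : set (X * dual X) := [set p | T p.1 p.2].

Definition monotone_multifun T := forall x xs y ys,
  multifun_graph T (x, xs) -> multifun_graph T (y, ys) ->
  0 <= (xs - ys) (x - y).

Definition maximal_monotone_multifun T :=
  monotone_multifun T /\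
  ~ exists S, monotone_multifun S /\ multifun_graph T `<` multifun_graph S.

Definition multifun_add T S : X -> set (dual X) :=
  fun x => [set xs + us | xs in T x & us in S x].

Definition bounded_multifun S :=
  exists2 M : R, 0 <= M &
    forall y us, multifun_graph S (y, us) -> `|us| <= M.

Local Open Scope ereal_scope.

(* The quantity L(x, xs, T); when G(T) has no point (y, ys) with y != x, the
   supremum is -oo and the value is 0. *)
Definition mono_excess x xs T : \bar R :=
  maxe 0 (ereal_sup
    [set (((xs - p.2) (p.1 - x)) / `|x - p.1|)%R%:E
       | p in [set p | multifun_graph T p /\ p.1 != x]]).

(* Equal to +oo when A is empty. *)
Definition dual_distance xs (A : set (dual X)) : \bar R :=
  ereal_inf [set `|ys - xs|%R%:E | ys in A].

Definition regular_multifun T :=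
  maximal_monotone_multifun T /\
  forall x xs, mono_excess x xs T = dual_distance xs (T x).

End multifunctions.

(* Main.v *)
(* Let (x, xs) be monotonically related to T + S, with S bounded by M.  Since S
   has full domain, <xs - ys, y - x> <= M |y - x| on the graph of T, so that
   L(x, xs, T) <= M and regularity gives T(x) nonempty.  Consequently no point
   (v, vs) satisfies <v - y, vs - ws> > 0 on the whole graph of T + S.
   Writing F_T(v, vs) = sup <v, ys> + <y, vs> - <y, ys> over the graph of T, this
   makes c + M |z| nonnegative on the convex set of pairs (z, c) with z = w - v
   and c the sum of bounds on F_T and F_S at (v, vs) and (w, ws), centred at
   (x, xs).  A Hahn-Banach (Mazur-Orlicz) functional u with u z <= c on that set
   gives (x, xs - u) related to T and (x, u) related to S, hence xs in
   T(x) + S(x) by maximality. *)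

From HB Require Import structures.
Require Import Defs.
From mathcomp Require Import all_boot all_order all_algebra.
From mathcomp Require Import all_classical all_reals all_analysis.
From mathcomp Require Import ring lra.

Set Implicit Arguments.
Unset Strict Implicit.
Unset Printing Implicit Defensive.

Import Order.TTheory GRing.Theory Num.Theory.
Import numFieldNormedType.Exports.

Local Open Scope classical_set_scope.
Local Open Scope ring_scope.

(** * Sublinear functionals and the Hahn-Banach theorem *)

Definition sublinear (R : realType) (V : lmodType R) (p : V -> R) :=
  (forall x y, p (x + y) <= p x + p y) /\
  (forall t x, 0 <= t -> p (t *: x) <= t * p x).

Section sublinear.
Context (R : realType) (V : lmodType R).
Implicit Types (p q : V -> R) (K : V -> set R).

Lemma sublinear0 p : sublinear p -> p 0 = 0.
Proof.
move=> [pD pZ]; apply/eqP; rewrite eq_le; apply/andP; split.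
  by have := pZ 0 0 (lexx 0); rewrite scale0r mul0r.
by have := pD 0 0; rewrite addr0; lra.
Qed.

Lemma sublinear_oppr_ge p x : sublinear p -> - p (- x) <= p x.
Proof.
move=> sp; have := sp.1 x (- x); rewrite subrr (sublinear0 sp); lra.
Qed.

(** Take the infimal convolution [q x = inf { p (x + y) + a | K y a }] with the convex cone [K];
    subadditivity and [0 <= p y + a] keep it above [- p (- x)]. Linear functionals below [q] inherit
    the constraints coded by [K]. *)
Lemma sublinear_infconv p K : sublinear p -> K 0 0 ->
    (forall x y a b, K x a -> K y b -> K (x + y) (a + b)) ->
    (forall t x a, 0 <= t -> K x a -> K (t *: x) (t * a)) ->
    (forall x a, K x a -> 0 <= p x + a) ->
  exists q, [/\ sublinear q, forall x, q x <= p x &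
    forall x a, K x a -> q (- x) <= a].
Proof.
move=> sp K0 KD KZ pK; have [pD pZ] := sp.
pose E x := [set c | exists y a, K y a /\ c = p (x + y) + a].
have En x : E x !=set0 by exists (p (x + 0) + 0), 0, 0.
have El x : has_lbound (E x).
  exists (- p (- x)) => _ [y [a [Kya ->]]].
  have := pD (- x) (x + y); have := pK _ _ Kya; rewrite addKr; lra.
have qle x y a : K y a -> inf (E x) <= p (x + y) + a.
  by move=> Kya; apply: ge_inf => //; exists y, a.
exists (fun x => inf (E x)); split.
- split=> [x y|t x t0].
    rewrite -lerBlDr; apply: lb_le_inf => // _ [z [a [Kza ->]]].
    rewrite lerBlDr -lerBlDl; apply: lb_le_inf => // _ [w [b [Kwb ->]]].
    rewrite lerBlDl (le_trans (qle _ _ _ (KD _ _ _ _ Kza Kwb)))//.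
    have := pD (x + z) (y + w); rewrite addrACA; lra.
  have [->|tn0] := eqVneq t 0.
    by rewrite scale0r mul0r (le_trans (qle _ _ _ K0))// !addr0 (sublinear0 sp).
  have {tn0 t0} t0 : 0 < t by rewrite lt_neqAle eq_sym tn0.
  rewrite -ler_pdivrMl//; apply: lb_le_inf => // _ [z [a [Kza ->]]].
  rewrite ler_pdivrMl// (le_trans (qle _ _ _ (KZ t _ _ (ltW t0) Kza)))//.
  by rewrite -scalerDr mulrDr lerD2r pZ// ltW.
- by move=> x; rewrite (le_trans (qle _ _ _ K0))// !addr0.
- move=> x a Kxa; rewrite (le_trans (qle _ _ _ Kxa))//.
  by rewrite addNr (sublinear0 sp) add0r.
Qed.

(** Zorn's lemma for the reversed pointwise order. A nonempty chain is bounded by its pointwise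
    infimum, finite because [q <= p] forces [q x >= - q (- x) >= - p (- x)]. *)
Lemma minimal_sublinear p : sublinear p ->
  exists q, [/\ sublinear q, forall x, q x <= p x &
    forall r, sublinear r -> (forall x, r x <= q x) -> r = q].
Proof.
move=> sp.
pose P q := sublinear q /\ forall x, q x <= p x.
pose T := {q : V -> R | P q}.
pose ge (q r : T) := `[< forall x, sval r x <= sval q x >].
have [|||A totA|[q [sq qp]] qmin] := @Zorn T ge.
- by move=> q; apply/asboolP.
- move=> q r s /asboolP qr /asboolP rs; apply/asboolP => x.
  exact: le_trans (rs x) (qr x).
- move=> [q hq] [r hr] /asboolP/= qr /asboolP/= rq; apply: eq_exist => /=.
  by apply/funext => x; apply/eqP; rewrite eq_le qr rq.
- have [[q0 Aq0]|A0] := pselect (A !=set0); last first.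
    exists (exist P p (conj sp (fun x => lexx (p x)))) => q Aq.
    by exfalso; apply: A0; exists q.
  pose E x := [set sval q x | q in A].
  have En x : E x !=set0 by exists (sval q0 x), q0.
  have El x : has_lbound (E x).
    exists (- p (- x)) => _ [[q [sq qp]] _ <-] /=.
    by have := sublinear_oppr_ge x sq; have := qp (- x); lra.
  have qle x (q : T) : A q -> inf (E x) <= sval q x.
    by move=> Aq; apply: ge_inf => //; exists q.
  have sE : sublinear (fun x => inf (E x)).
    split=> [x y|t x t0].
      rewrite -lerBlDr; apply: lb_le_inf => // _ [q Aq <-].
      rewrite lerBlDr -lerBlDl; apply: lb_le_inf => // _ [r Ar <-].
      rewrite lerBlDl.
      (* The smaller of the two chain members serves at both [x] and [y], so its own subadditivity
         suffices. *)
      have [/asboolP rq|/asboolP qr] := totA _ _ Aq Ar.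
        by apply: (le_trans (qle _ _ Ar)); have := (svalP r).1.1 x y;
          have := rq x; lra.
      by apply: (le_trans (qle _ _ Aq)); have := (svalP q).1.1 x y;
        have := qr y; lra.
    have [->|tn0] := eqVneq t 0.
      rewrite scale0r mul0r (le_trans (qle _ _ Aq0))//.
      by rewrite (sublinear0 (svalP q0).1).
    have {tn0 t0} t0 : 0 < t by rewrite lt_neqAle eq_sym tn0.
    rewrite -ler_pdivrMl//; apply: lb_le_inf => // _ [q Aq <-].
    rewrite ler_pdivrMl// (le_trans (qle _ _ Aq))//.
    by apply: (svalP q).1.2; exact: ltW.
  have Ep x : inf (E x) <= p x.
    by rewrite (le_trans (qle _ _ Aq0))//; exact: (svalP q0).2.
  exists (exist P _ (conj sE Ep)) => q Aq; apply/asboolP => x /=.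
  exact: qle.
- exists q; split=> // r sr rq.
  have rp x : r x <= p x by exact: le_trans (rq x) (qp x).
  have /(_ _)/(congr1 sval) := qmin (exist P r (conj sr rp)); apply.
  exact/asboolP.
Qed.

(* Minimality is tested against the infimal convolution along the ray
   {(t x, - t q x)}, which gives q (- x) <= - q x. *)
Lemma linear_le_sublinear p : sublinear p ->
  exists2 u : V -> R^o, linear u & forall x, u x <= p x.
Proof.
move=> /minimal_sublinear[q [sq qp qmin]]; exists q => //.
have [qD qZ] := sq.
have qN x : q (- x) = - q x.
  pose K z := [set a : R | exists t, [/\ 0 <= t, z = t *: x & a = - (t * q x)]].
  have [||||r [sr rq rK]] := @sublinear_infconv q K sq.
  - by exists 0; rewrite scale0r mul0r oppr0.
  - move=> _ _ _ _ [s [s0 -> ->]] [t [t0 -> ->]]; exists (s + t).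
    by split; [exact: addr_ge0|rewrite scalerDl|ring].
  - move=> s _ _ s0 [t [t0 -> ->]]; exists (s * t).
    by split; [exact: mulr_ge0|rewrite scalerA|ring].
  - move=> _ _ [t [t0 -> ->]].
    have [->|tn0] := eqVneq t 0.
      by rewrite scale0r mul0r (sublinear0 sq) subr0.
    have {tn0 t0} t0 : 0 < t by rewrite lt_neqAle eq_sym tn0.
    rewrite subr_ge0 -ler_pdivlMl//.
    have := qZ t^-1 (t *: x); rewrite scalerA mulVf ?gt_eqF// scale1r.
    by apply; rewrite invr_ge0 ltW.
  - have eqr := qmin _ sr rq; subst r.
    apply/eqP; rewrite eq_le; apply/andP; split.
      by apply: rK; exists 1; rewrite scale1r mul1r.
    by have := sublinear_oppr_ge x sq; lra.
have qDE x y : q (x + y) = q x + q y.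
  apply/eqP; rewrite eq_le qD/=.
  by have := qD (- x) (- y); rewrite -opprD !qN; lra.
have qZE t x : 0 <= t -> q (t *: x) = t * q x.
  move=> t0; apply/eqP; rewrite eq_le qZ//=.
  by have := qZ t (- x) t0; rewrite scalerN !qN; lra.
move=> t x y; rewrite /= qDE; congr (_ + _).
have [t0|t0] := leP 0 t; first exact: qZE.
rewrite -[t]opprK scaleNr qN qZE ?oppr_ge0 ?ltW//.
by rewrite -mulNr.
Qed.

End sublinear.

(** * Separation by a continuous functional *)

Section mazur_orlicz.
Context (R : realType) (X : normedModType R).

(** The one-sided bound applied to [- x] controls [|u x|], and bounded linear maps are
    continuous. *)
Lemma linear_norm_le_dual (u : X -> R^o) (M : R) : linear u ->
  (forall x, u x <= M * `|x|) -> exists f : dual X, forall x, f x = u x.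
Proof.
move=> lu uM.
pose u' := GRing.isLinear.Build R X R^o *:%R u lu.
pose v : {linear X -> R^o} := HB.pack u u'.
have cu : continuous v.
  apply/linear_bounded_continuous/linear_boundedP.
  near=> r => x; have -> : v x = u x by [].
  have Mr : M * `|x| <= r * `|x| by rewrite ler_wpM2r.
  rewrite ler_norml (le_trans (uM x))// andbT.
  rewrite lerNl -[- u x]/(- v x) -linearN (le_trans (uM _))// normrN//.
have uP : u \in @dual_pred R X by rewrite inE; split.
by exists (Dual uP).
Unshelve. all: by end_near. Qed.

Lemma dual_separation (C : X -> set R) (M : R) : 0 <= M ->
    (exists x, C x !=set0) ->
    (forall x y a b t, 0 <= t <= 1 -> C x a -> C y b ->
      C (t *: x + (1 - t) *: y) (t * a + (1 - t) * b)) ->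
    (forall x a, C x a -> 0 <= a + M * `|x|) ->
  exists u : dual X, forall x a, C x a -> u x <= a.
Proof.
move=> M0 [x0 [a0 Cxa0]] cvxC CM.
have sM : sublinear (fun x : X => M * `|x|).
  split=> [x y|t x t0]; first by rewrite -mulrDr ler_wpM2l// ler_normD.
  by rewrite normrZ ger0_norm// mulrCA.
(* The cone generated by the pairs [(- x, a)] with [C x a]; the sign turns the conclusion
   [q (- z) <= c] into [q x <= a]. *)
pose K z := [set c : R | exists x a t,
  [/\ C x a, 0 <= t, z = - (t *: x) & c = t * a]].
have [||||q [sq qM qK]] := @sublinear_infconv _ _ _ K sM.
- by exists x0, a0, 0; split=> //; rewrite ?scale0r ?oppr0 ?mul0r.
- move=> _ _ _ _ [x [a [s [Cx s0 -> ->]]]] [y [b [t [Cy t0 -> ->]]]].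
  (* If [s + t = 0] the weights cannot be normalised, but both vanish and any point of [C] is a
     witness. *)
  have [st0|st0] := eqVneq (s + t) 0.
    have [s_0 t_0] : s = 0 /\ t = 0 by lra.
    exists x, a, 0; split=> //.
      by rewrite s_0 t_0 !scale0r !oppr0 addr0.
    by rewrite s_0 t_0 !mul0r addr0.
  pose r := s / (s + t).
  have str : (s + t) * r = s by rewrite mulrC divfK.
  have str' : (s + t) * (1 - r) = t by rewrite mulrBr str; ring.
  exists (r *: x + (1 - r) *: y), (r * a + (1 - r) * b), (s + t).
  split; last 3 first.
  - exact: addr_ge0.
  - by rewrite scalerDr !scalerA str str' opprD.
  - by rewrite mulrDr (mulrA _ r) (mulrA _ (1 - r)) str str'.
  apply: cvxC => //; rewrite /r divr_ge0 ?addr_ge0//=.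
  by rewrite ler_pdivrMr ?mul1r ?lerDl// lt_neqAle eq_sym st0 addr_ge0.
- move=> s _ _ s0 [x [a [t [Cx t0 -> ->]]]]; exists x, a, (s * t).
  by split; [|exact: mulr_ge0|rewrite scalerN scalerA|rewrite mulrA].
- move=> _ _ [x [a [t [Cx t0 -> ->]]]]; rewrite normrN normrZ ger0_norm//.
  by rewrite mulrCA -mulrDr mulr_ge0// addrC CM.
have [u lu uq] := linear_le_sublinear sq.
have [f fu] := linear_norm_le_dual lu (fun x => le_trans (uq x) (qM x)).
exists f => x a Cx; rewrite fu (le_trans (uq _))//.
rewrite -[x]opprK; apply: qK.
by exists x, a, 1; split; rewrite ?scale1r ?mul1r.
Qed.

End mazur_orlicz.

(** This replaces the limit as t tends to 0: if [c < 0] then [d < 0], and [t = c / d / 2] yields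
    [c / 2 <= c], a contradiction. *)
Lemma ge0_of_scaled_le (R : realFieldType) (c d : R) :
  (forall t, 0 < t <= 1 -> t * d <= c) -> 0 <= c.
Proof.
move=> h; rewrite leNgt; apply/negP => c0.
have dc : d <= c by have := h 1; rewrite ltr01 lexx mul1r; apply.
have d0 : d < 0 by exact: le_lt_trans c0.
have cd0 : 0 < c / d by rewrite nmulr_rgt0 // invr_lt0.
have cd1 : c / d <= 1 by rewrite ler_ndivrMr// mul1r.
have : c / d / 2 * d <= c by apply: h; apply/andP; split; lra.
by rewrite mulrAC divfK ?lt_eqF//; lra.
Qed.

(** * Monotone multifunctions and their sum *)

Section multifunctions.
Context (R : realType) (X : normedModType R).
Implicit Types (T S : X -> set (dual X)) (x y v w : X) (xs ys us vs ws : dual X).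

Lemma dualDE xs ys x : (xs + ys) x = (xs x : R) + ys x. Proof. by []. Qed.

Lemma dualNE xs x : (- xs) x = - (xs x : R). Proof. by []. Qed.

Lemma dualZE (t : R) xs x : (t *: xs) x = t * (xs x : R). Proof. by []. Qed.

Lemma dualD xs x y : xs (x + y) = (xs x : R) + xs y. Proof. exact: linearD. Qed.

Lemma dualN xs x : xs (- x) = - (xs x : R). Proof. exact: linearN. Qed.

Lemma dualZ xs (t : R) x : xs (t *: x) = t * (xs x : R).
Proof. exact: linearZ. Qed.

Definition dualE := (dualDE, dualNE, dualZE, dualD, dualN, dualZ).

Lemma maximal_monotone_mem T x xs : maximal_monotone_multifun T ->
  (forall y ys, T y ys -> 0 <= (xs - ys) (x - y)) -> T x xs.
Proof.
move=> [monT maxT] Txs; apply: contrapT => nTx; apply: maxT.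
pose S y := [set ys | T y ys \/ (y = x /\ ys = xs)].
have monS y ys z zs : S y ys -> S z zs -> 0 <= (ys - zs) (y - z).
  move=> [Ty|[-> ->]] [Tz|[-> ->]].
  - exact: monT.
  - by have := Txs _ _ Ty; rewrite !dualE; lra.
  - exact: Txs.
  - by rewrite !dualE; lra.
exists S; split=> [y ys z zs|]; first exact: monS.
by split=> [[y ys] Ty|/(_ (x, xs))]; [left|move=> sub; apply/nTx/sub; right].
Qed.

Lemma maximal_monotone_intro T : monotone_multifun T ->
  (forall x xs, (forall y ys, T y ys -> 0 <= (xs - ys) (x - y)) -> T x xs) ->
  maximal_monotone_multifun T.
Proof.
move=> monT memT; split=> // -[S [monS [TS nST]]]; apply: nST => -[x xs] Sx.
apply: memT => y ys Ty; apply: monS Sx _; exact: (TS (y, ys)).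
Qed.

(** A related point needs only some value of [T] at [v], since a graph point over [v] itself has
    pairing 0; an unrelated point has a negative pairing. *)
Lemma exists_nonpos_pairing T v vs :
    ((forall y ys, T y ys -> 0 <= (vs - ys) (v - y)) -> T v !=set0) ->
  exists y ys, T y ys /\ (vs - ys) (v - y) <= 0.
Proof.
move=> Tv.
have [h|/existsNP[y /existsNP[ys /not_implyP[Ty /negP]]]] :=
    pselect (forall y ys, T y ys -> 0 <= (vs - ys) (v - y)).
  by have [t Tt] := Tv h; exists v, t; split=> //; rewrite !dualE; lra.
by rewrite -ltNge => /ltW h; exists y, ys.
Qed.

(* The Fitzpatrick function of [T] is at most [a] at [(v, vs)]. *)
Definition fitzpatrick_le T v vs (a : R) :=
  forall y ys, T y ys -> (ys v : R) + vs y - ys y <= a.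

(** For a fixed graph point the bounded expression is affine in [(v, vs)]. *)
Lemma fitzpatrick_le_convex T v vs a w ws b t : 0 <= t <= 1 ->
    fitzpatrick_le T v vs a -> fitzpatrick_le T w ws b ->
  fitzpatrick_le T (t *: v + (1 - t) *: w) (t *: vs + (1 - t) *: ws)
    (t * a + (1 - t) * b).
Proof.
move=> /andP[t0 t1] Ta Tb y ys Ty; rewrite !dualE.
have : t * ((ys v : R) + vs y - ys y) <= t * a by rewrite ler_wpM2l// Ta.
have : (1 - t) * ((ys w : R) + ws y - ys y) <= (1 - t) * b.
  by rewrite ler_wpM2l ?subr_ge0// Tb.
lra.
Qed.

Lemma fitzpatrick_le_graph T v vs : monotone_multifun T -> T v vs ->
  fitzpatrick_le T v vs (vs v).
Proof.
by move=> monT Tv y ys Ty; have := monT _ _ _ _ Tv Ty; rewrite !dualE; lra.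
Qed.

Lemma bounded_le T M : (forall y us, T y us -> `|us| <= M) ->
  forall y us x, T y us -> us x <= M * `|x|.
Proof.
move=> TM y us x Ty; rewrite (le_trans (ler_norm _))//.
by rewrite (le_trans (dual_normP _ _))// ler_wpM2r// (TM _ _ Ty).
Qed.

(** Separation applied to the Fitzpatrick bounds of [S] centred at [x] gives [u] with [(x, u)]
    related to [S], so maximality puts [u] in [S x]. *)
Lemma bounded_maximal_monotone_domain S x : maximal_monotone_multifun S ->
  bounded_multifun S -> S x !=set0.
Proof.
move=> maxS [M M0 /bounded_le SM]; have [monS _] := maxS.
pose C z := [set c : R | exists w ws b,
  [/\ fitzpatrick_le S w ws b, z = w - x & c = b - ws x]].
have test ws : exists y ys, S y ys /\ (ws - ys) (x - y) <= 0.
  apply: exists_nonpos_pairing => h.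
  by exists ws; exact: maximal_monotone_mem.
have CS y ys : S y ys -> C (y - x) (ys y - ys x).
  by move=> Sy; exists y, ys, (ys y); split=> //; exact: fitzpatrick_le_graph.
have [|_ _ _ _ t t01 [w [ws [b [Sw -> ->]]]] [w' [ws' [b' [Sw' -> ->]]]]|
      _ _ [w [ws [b [Sw -> ->]]]]|u uC] := @dual_separation _ _ C M M0.
- by have [y [ys [Sy _]]] := test 0; exists (y - x); eexists; exact: CS Sy.
- do 3!eexists; split; first exact: fitzpatrick_le_convex t01 Sw Sw'.
    by rewrite !scalerBr addrACA -opprD -scalerDl [t + _]addrC subrK scale1r.
  by rewrite !dualE; ring.
(* The tested point gives [b - ws x >= ys (w - x) >= - M * |w - x|]. *)
- have [y [ys [Sy]]] := test ws; rewrite !dualE.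
  have := Sw _ _ Sy; have := SM _ _ (- (w - x)) Sy.
  by rewrite normrN !dualE; lra.
exists u; apply: maximal_monotone_mem => // y ys /CS/uC.
by rewrite !dualE; lra.
Qed.

Lemma regular_related_domain T S x xs :
    regular_multifun T -> (forall y, S y !=set0) -> bounded_multifun S ->
    (forall y ys, multifun_add T S y ys -> 0 <= (xs - ys) (x - y)) ->
  T x !=set0.
Proof.
move=> [_ regT] domS [M M0 /bounded_le SM] TSx.
have le_M : (mono_excess x xs T <= M%:E)%E.
  rewrite /mono_excess ge_max lee_fin M0/=.
  apply: ge_ereal_sup => _ [[y ys] [Ty yx] <-]; rewrite lee_fin.
  rewrite -[leLHS]/((xs - ys) (y - x) / `|x - y|) ler_pdivrMr;
    last by rewrite normr_gt0 subr_eq0 eq_sym.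
  have [us Su] := domS y.
  have : 0 <= (xs - (ys + us)) (x - y) by apply: TSx; exists ys => //; exists us.
  by have := SM _ _ (y - x) Su; rewrite distrC !dualE; lra.
(* An empty [T x] is at distance +oo, which regularity forbids. *)
apply/set0P/eqP => Tx0; move: le_M.
by rewrite regT /dual_distance Tx0 image_set0 ereal_inf0 leye_eq.
Qed.

Lemma monotone_multifun_add T S : monotone_multifun T -> monotone_multifun S ->
  monotone_multifun (multifun_add T S).
Proof.
move=> monT monS.
have monTS x ws y ws' : multifun_add T S x ws -> multifun_add T S y ws' ->
    0 <= (ws - ws') (x - y).
  move=> [xs Tx [us Su <-]] [ys Ty [vs Sv <-]].
  have := monT _ _ _ _ Tx Ty; have := monS _ _ _ _ Su Sv.
  by rewrite !dualE; lra.
by move=> x ws y ws'; exact: monTS.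
Qed.

(* If (x, xs) is monotonically related to T + S, separation splits xs as
   (xs - u) + u with (x, xs - u) and (x, u) related to T and S.  The inequality
   required by [dual_separation] comes from testing T + S at the points
   (1 - t) (x, xs) + t (v, vs + ws) as t tends to 0. *)
Lemma multifun_add_related_mem T S x xs :
    maximal_monotone_multifun T -> maximal_monotone_multifun S ->
    bounded_multifun S -> T x !=set0 -> S x !=set0 ->
    (forall v vs, exists y ys, multifun_add T S y ys /\ (vs - ys) (v - y) <= 0) ->
    (forall y ys, multifun_add T S y ys -> 0 <= (xs - ys) (x - y)) ->
  multifun_add T S x xs.
Proof.
move=> maxT maxS [M M0 /bounded_le SM] [t0 Tt0] [s0 Ss0] NI TSx.
have [monT _] := maxT; have [monS _] := maxS.
pose C z := [set c : R | exists v vs a w ws b,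
  [/\ fitzpatrick_le T v vs a, fitzpatrick_le S w ws b, z = w - v &
  c = a + b - xs v - (vs + ws) x + xs x]].
(* Pairing with [(x, s0)] in the graph of [S] cancels [s0], leaving a condition on [T] alone; [t0]
   plays the symmetric role in [CS]. *)
have CT v vs : T v vs -> C (x - v) ((vs - xs) (v - x)).
  move=> Tv; exists v, vs, (vs v), x, s0, (s0 x).
  split; try exact: fitzpatrick_le_graph; first by [].
  by rewrite !dualE; ring.
have CS w ws : S w ws -> C (w - x) (ws (w - x)).
  move=> Sw; exists x, t0, (t0 x), w, ws, (ws w).
  split; try exact: fitzpatrick_le_graph; first by [].
  by rewrite !dualE; ring.
have [|_ _ _ _ t t01 [v [vs [a [w [ws [b [Tv Sw -> ->]]]]]]]
        [v' [vs' [a' [w' [ws' [b' [Tv' Sw' -> ->]]]]]]]|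
      _ _ [v [vs [a [w [ws [b [Tv Sw -> ->]]]]]]]|u uC] :=
  @dual_separation _ _ C M M0.
- by do 2!eexists; exact: CT Tt0.
- do 6!eexists; split; [exact: fitzpatrick_le_convex t01 Tv Tv'|
    exact: fitzpatrick_le_convex t01 Sw Sw'|..].
    by rewrite !scalerBr addrACA -opprD.
  by rewrite !dualE; ring.
- apply: (@ge0_of_scaled_le _ _ ((vs + ws - xs) (v - x))) => t.
  move=> /andP[t_gt0 t_le1].
  have [y [_ [[ys Ty [us Su <-]]]]] :=
    NI (t *: (v - x) + x) (t *: (vs + ws - xs) + xs).
  have := TSx _ _ (ex_intro2 _ _ _ Ty (ex_intro2 _ _ _ Su erefl)).
  set r := (xs - _) _ => r0 le0.
  (* Since [0 <= r] and [t <= 1], the constant term [r] of the expansion may be lowered to [t * r],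
     so that a factor [t] divides out. *)
  have {}le0 : t * (t * (vs + ws - xs) (v - x) + (xs - (ys + us)) (v - x) +
      (vs + ws - xs) (x - y) + r) <= 0.
    apply: le_trans le0.
    have : t * r <= r by rewrite ler_piMl.
    by rewrite /r !dualE; lra.
  rewrite pmulr_rle0// in le0.
  (* The bound on [S] is taken at [w] rather than [v]; the discrepancy [us (v - w)] costs at most
     [M * |w - v|]. *)
  have := Tv _ _ Ty; have := Sw _ _ Su; have := SM _ _ (- (w - v)) Su.
  by rewrite normrN; move: le0; rewrite /r !dualE; lra.
exists (xs - u); last exists u; rewrite ?subrK//.
  apply: maximal_monotone_mem => // v vs /CT/uC.
  by rewrite !dualE; lra.
by apply: maximal_monotone_mem => // w ws /CS/uC; rewrite !dualE; lra.
Qed.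

End multifunctions.

Theorem theorem1 (R : realType) (X : completeNormedModType R)
    (T S : X -> set (dual X))
    (regT : regular_multifun T)
    (maxS : maximal_monotone_multifun S) (bndS : bounded_multifun S) :
  maximal_monotone_multifun (multifun_add T S).
Proof.
have [maxT _] := regT.
have domS y : S y !=set0 by exact: bounded_maximal_monotone_domain.
apply: maximal_monotone_intro.
  by apply: monotone_multifun_add; [case: maxT|case: maxS].
move=> x xs TSx; apply: multifun_add_related_mem => //.
  exact: regular_related_domain TSx.
(* Regularity is used again, now at an arbitrary related point [(v, vs)], to put [v] in the domain
   of the sum. *)
move=> v vs; apply: exists_nonpos_pairing => TSv.
have [t Tt] := regular_related_domain regT domS bndS TSv.
have [s Ss] := domS v.
by exists (t + s), t => //; exists s.
Qed.
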